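(* Let $d>0$ be a constant and consider the random graph $G(n,d/n)$ with i.i.d. edge weights with $\Pr(w_{ij}=v_k)=p_k$, $k=1,\dots,K$. If $$d<\frac{2}{\max\{p_1,p_2,\dots,p_K\}},$$ then Algorithm 1 (greedy matching) runs in $O(\log n)$ time with high probability. That is, there is a constant $C$ (independent of $n$) such that the probability that Algorithm 1 terminates within $C\log n$ iterations tends to $1$ as $n\to\infty$.
   Context: $G(n,d/n)$ is the Erdős–Rényi random graph on $n$ users in which each pair of users is joined independently with probability $d/n$. Edge weights are i.i.d. (and independent of the graph), taking values in the finite set $\{v_1,\dots,v_K\}$, $0\le v_1<\cdots<v_K$, with $\Pr(w_{ij}=v_k)=p_k$, $\sum_k p_k=1$; $K$, the $v_k$ and the $p_k$ are fixed as $n\to\infty$. Algorithm 1 (greedy matching): initially all users are unmatched. Each iteration has two phases. Proposal phase: every unmatched user having at least one unmatched neighbor sends a proposal to the unmatched neighbor to which it is joined by the edge of largest weight; nodes are assigned unique numbers (fixed independently of the graph and the weights), and ties are broken in favor of the neighbor with the highest number. Matching phase: every pair of users that proposed to each other is matched and becomes unavailable to others. The algorithm stops when no unmatched user has an unmatched neighbor. All users act in parallel, and one unit of time is one iteration (one proposal phase followed by one matching phase). *)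

(* Defs.v *)
From HB Require Import structures.
From mathcomp Require Import all_boot all_order all_algebra.
From mathcomp Require Import all_classical all_reals all_analysis.
Import Order.TTheory GRing.Theory Num.Theory.
Import numFieldNormedType.Exports.

Set Implicit Arguments.
Unset Strict Implicit.
Unset Printing Implicit Defensive.

Local Open Scope classical_set_scope.
Local Open Scope ring_scope.

Section Greedy.
Variables (R : realType) (T : finType).
(* Adjacency, edge weights (only read on adjacent pairs) and user numbers. *)
Variables (adj : rel T) (w : T -> T -> R) (num : T -> nat).

(* [mu i = Some j] when [i] has been matched to [j], [None] when [i] is still
   unmatched. *)
Definition matching_state := {ffun T -> option T}.

Definition unmatched (mu : matching_state) (i : T) : bool := mu i == None.

Definition available (mu : matching_state) (i j : T) : bool :=
  adj i j && unmatched mu j.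

Definition no_worse (i j k : T) : bool :=
  (w i k < w i j) || ((w i k == w i j) && (num k <= num j)%N).

(* When [num] is injective at most one [j] satisfies the condition below, so
   the proposal does not depend on how [pick] chooses. *)
Definition proposal (mu : matching_state) (i : T) : option T :=
  if unmatched mu i then
    [pick j | available mu i j &&
              [forall k, available mu i k ==> no_worse i j k]]
  else None.

Definition greedy_step (mu : matching_state) : matching_state :=
  [ffun i => if mu i is Some j then Some j
             else if proposal mu i is Some j then
               if proposal mu j == Some i then Some j else None
             else None].

Definition greedy_state (m : nat) : matching_state :=
  iter m greedy_step [ffun => None].

Definition stopped (mu : matching_state) : bool :=
  [forall i, forall j, unmatched mu i ==> ~~ available mu i j].

Definition greedy_runs_within (B : R) : Prop :=
  exists m : nat, m%:R <= B /\ stopped (greedy_state m).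

End Greedy.

Section RandomWeightedGraph.
Variables (R : realType) (n K : nat).

(* The unordered pairs of distinct users, each listed once. *)
Definition user_pair := {e : 'I_n * 'I_n | (e.1 < e.2)%N}.

(* An edge set, and for every pair (edge or not) the index of its weight. *)
Definition outcome := ({set user_pair} * {ffun user_pair -> 'I_K})%type.

(* [None] exactly when [i = j]. *)
Definition pair_of (i j : 'I_n) : option user_pair :=
  insub (if (i < j)%N then (i, j) else (j, i)).

Definition adj_of (o : outcome) : rel 'I_n :=
  fun i j => if pair_of i j is Some e then e \in o.1 else false.

Definition weight_of (v : 'I_K -> R) (o : outcome) (i j : 'I_n) : R :=
  if pair_of i j is Some e then v (o.2 e) else 0.

(* The product law: each pair is an edge with probability [q] and carries the
   [k]-th weight with probability [p k], all these choices being independent.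
   For [q = d / n] this is a genuine probability as soon as [n >= d]. *)
Definition mass (q : R) (p : 'I_K -> R) (o : outcome) : R :=
  (\prod_(e : user_pair) (if e \in o.1 then q else 1 - q)) *
  \prod_(e : user_pair) p (o.2 e).

Definition prob (q : R) (p : 'I_K -> R) (A : set outcome) : R :=
  \sum_(o : outcome | o \in A) mass q p o.

End RandomWeightedGraph.

(* Main.v *)
(* Whenever an edge joining two unmatched users survives an iteration, one of
   its ends proposed elsewhere, so an adjacent edge of larger weight, or of equal
   weight leading to a user of larger number, was alive one iteration earlier.
   By pigeonhole on the K weights, surviving s * K iterations produces a chain of
   s.+1 edges of equal weight.  Along it one end at a time is replaced by a user
   of larger number; hence its edges are pairwise distinct, and a generating
   function in the number of larger-numbered users bounds the expected number of
   chains by n * d * exp(4 * theta) * (d / theta) ^ s for every theta > 0.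
   Taking theta = d * e ^ 2 and s >= ln n gives O(1 / n). *)
Require Import Defs.
From HB Require Import structures.
From mathcomp Require Import all_boot all_order all_algebra.
From mathcomp Require Import all_classical all_reals all_analysis.
From mathcomp Require Import ring.
Import Order.TTheory GRing.Theory Num.Theory.
Import numFieldNormedType.Exports.

Set Implicit Arguments.
Unset Strict Implicit.
Unset Printing Implicit Defensive.

Local Open Scope classical_set_scope.
Local Open Scope ring_scope.

(** * From surviving edges to chains, for a fixed weighted graph *)

Section Chains.
Variables (T : finType) (adj : rel T) (num : T -> nat).

(** Read backwards in time, with [s.+1] edges in all. Weights are left out, so that the event
    depends on the edge set alone. *)
Fixpoint chain (s : nat) (a b : T) : bool :=
  adj a b && (if s is s'.+1 then
    [exists c, (num b < num c)%N && chain s' a c] ||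
    [exists c, (num a < num c)%N && chain s' c b] else true).

Variables (R : realType) (w : T -> T -> R).
Hypotheses (adjC : symmetric adj) (wC : forall a b, w a b = w b a).
Hypothesis num_inj : injective num.

Let state := greedy_state adj w num.

Definition alive (t : nat) (a b : T) : bool :=
  [&& adj a b, unmatched (state t) a & unmatched (state t) b].

Lemma aliveC t a b : alive t a b = alive t b a.
Proof. by rewrite /alive adjC [unmatched _ a && _]andbC. Qed.

Lemma not_stopped_alive t : ~~ stopped adj (state t) -> exists a b, alive t a b.
Proof.
move=> /forallPn[a /forallPn[b]]; rewrite negb_imply negbK => /andP[ua /andP[ab ub]].
by exists a, b; rewrite /alive ab ua ub.
Qed.

Lemma unmatched_pred t a : unmatched (state t.+1) a -> unmatched (state t) a.
Proof. by rewrite /unmatched /state /= ffunE; case: (greedy_state _ _ _ t a). Qed.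

(** Injectivity of [num] excludes a second best neighbor, so [pick] can only return [b]. *)
Lemma proposal_best (mu : matching_state T) a b :
  unmatched mu a -> available adj mu a b ->
  (forall c, available adj mu a c -> no_worse w num a b c) ->
  proposal adj w num mu a = Some b.
Proof.
move=> ua ab bP; rewrite /proposal ua; case: pickP => [c|/(_ b)]; last first.
  by rewrite ab /=; move/negbT/forallPn => [c]; rewrite negb_imply => /andP[/bP->].
move=> /andP[ac /forallP/(_ b)]; rewrite ab /= => ccb.
congr Some; apply: num_inj; move: ccb (bP c ac); rewrite /no_worse.
case: (ltgtP (w a b) (w a c)) => //= _ cb bc.
by apply/eqP; rewrite eqn_leq cb bc.
Qed.

(** The negation of [no_worse] for the same three users. *)
Definition outranks (a b c : T) :=
  (w a b < w a c) || ((w a b == w a c) && (num b < num c)%N).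

Lemma proposal_blocked t a b : alive t a b ->
  proposal adj w num (state t) a != Some b ->
  exists2 c, outranks a b c & alive t a c.
Proof.
move=> /and3P[ab ua ub] nb.
have : ~~ [forall c, available adj (state t) a c ==> no_worse w num a b c].
  apply: contra nb => /forallP h; apply/eqP/proposal_best => //.
    by rewrite /available ab ub.
  by move=> c; apply/implyP.
move=> /forallPn[c]; rewrite negb_imply => /andP[/andP[ac uc] nw].
exists c; last by rewrite /alive ac ua uc.
move: nw; rewrite /no_worse /outranks.
by case: (ltgtP (w a b) (w a c)) => //= _; rewrite -ltnNge.
Qed.

(** Two users proposing to each other would be matched in that very iteration, so at least one of
    them was drawn to an outranking neighbor. *)
Lemma alive_blocked t a b : alive t.+1 a b ->
  (exists2 c, outranks a b c & alive t a c) \/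
  (exists2 c, outranks b a c & alive t c b).
Proof.
move=> /and3P[ab ua' ub'].
have ua := unmatched_pred ua'; have ub := unmatched_pred ub'.
have al : alive t a b by rewrite /alive ab ua ub.
have [pa|] := eqVneq (proposal adj w num (state t) a) (Some b); last first.
  by move=> /(proposal_blocked al); left.
have [pb|] := eqVneq (proposal adj w num (state t) b) (Some a).
  move: ua' ua; rewrite /unmatched /state /= ffunE; case: (greedy_state _ _ _ t a) => //.
  by rewrite pa pb eqxx.
rewrite aliveC in al; move=> /(proposal_blocked al)[c bac bc].
by right; exists c; rewrite // aliveC.
Qed.

(** Blocking edges are followed back in time: at equal weight the chain grows, and the first strict
    increase gives the second alternative. There [t <= t' + s] bounds the iterations spent. *)
Lemma alive_chain s t a b : alive t a b -> (s <= t)%N ->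
  chain s a b \/
  exists t' c c', [/\ alive t' c c', w a b < w c c' & (t <= t' + s)%N].
Proof.
elim: s t a b => [|s IH] [|t] a b //= al st; try by left; case/andP: al => ->.
have ab : adj a b by case/and3P: al.
have [[c] r alc|[c] r alc] := alive_blocked al.
  case/orP: r => [lt|/andP[/eqP e r]].
    by right; exists t, a, c; split => //; rewrite addnS ltnS leq_addr.
  have [h|[t' [x [y [h1 h2 h3]]]]] := IH _ _ _ alc st.
    by left; rewrite ab; apply/orP; left; apply/existsP; exists c; rewrite r h.
  by right; exists t', x, y; rewrite e addnS.
case/orP: r => [lt|/andP[/eqP e r]].
  by right; exists t, c, b; split => //; [rewrite wC (wC c)|rewrite addnS ltnS leq_addr].
have [h|[t' [x [y [h1 h2 h3]]]]] := IH _ _ _ alc st.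
  by left; rewrite ab; apply/orP; right; apply/existsP; exists c; rewrite r h.
by right; exists t', x, y; rewrite wC e wC addnS.
Qed.

Variables (K : nat) (v : 'I_K -> R).
Hypothesis v_incr : forall k l : 'I_K, (k < l)%N -> v k < v l.
Hypothesis w_val : forall a b, adj a b -> exists k, w a b = v k.

(** Pigeonhole as an induction on [K - k], the number of weight values from [v k] upwards: each
    strict increase uses up at most [s] iterations. *)
Lemma alive_long_chain s t k a b : alive t a b -> w a b = v k ->
  (s * (K - k) <= t)%N -> exists a b, chain s a b.
Proof.
have [m] := ubnP (K - k); elim: m t k a b => // m IH t k a b km al wk st.
have kK := ltn_ord k.
have st' : (s <= t)%N.
  by apply: leq_trans st; rewrite leq_pmulr // subn_gt0.
have [h|[t' [x [y [alx]]]]] := alive_chain al st'; first by exists a, b.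
have [l wl] := w_val (proj1 (andP alx)); rewrite wk wl => vkl tt.
have kl : (k < l)%N.
  rewrite ltnNge leq_eqVlt; apply/negP => /orP[/eqP/val_inj e|/v_incr h].
    by rewrite e ltxx in vkl.
  by have := lt_trans vkl h; rewrite ltxx.
apply: (IH t' l x y) => //.
  by rewrite -ltnS; apply: leq_trans km; rewrite ltnS ltn_sub2l.
(* Since [k < l], one block of [s] iterations is freed, which pays for going from [t] back to
   [t']. *)
rewrite -(leq_add2r s); apply: leq_trans tt; apply: leq_trans st.
by rewrite addnC -mulnS leq_mul2l ltn_sub2l ?orbT.
Qed.

Lemma no_chain_stopped s : (forall a b, ~~ chain s a b) -> stopped adj (state (s * K)).
Proof.
move=> nc; apply: contraT => /not_stopped_alive[a [b al]].
have [k wk] := w_val (proj1 (andP al)).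
have [|x [y]] := @alive_long_chain s (s * K) k a b al wk; last by rewrite (negbTE (nc x y)).
by rewrite leq_mul2l leq_subr orbT.
Qed.

End Chains.

(** * Union bounds for finite sums *)

Lemma sum_exists_le (R : realType) (I J : finType) (F : J -> R) (A : pred I)
    (Q : I -> pred J) : (forall j, 0 <= F j) ->
  \sum_(j | [exists i, A i && Q i j]) F j <= \sum_(i | A i) \sum_(j | Q i j) F j.
Proof.
move=> F0; rewrite (exchange_big_dep xpredT) //= big_mkcond /=.
apply: ler_sum => j _; case: existsP => [[i Ai]|_]; last exact: sumr_ge0.
by rewrite (bigD1 i) //= lerDl; apply: sumr_ge0.
Qed.

Lemma sum_or_le (R : realType) (J : finType) (F : J -> R) (P Q : pred J) :
  (forall j, 0 <= F j) ->
  \sum_(j | P j || Q j) F j <= \sum_(j | P j) F j + \sum_(j | Q j) F j.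
Proof.
move=> F0; rewrite [X in _ <= X + _]big_mkcond [X in _ <= _ + X]big_mkcond
  [X in X <= _]big_mkcond /=.
rewrite -big_split /=; apply: ler_sum => j _.
by case: (P j); case: (Q j) => //=; rewrite ?addr0 ?add0r // lerDl.
Qed.

(** * Ranks of users and geometric sums over them *)

Section Rank.
Variables (n : nat) (num : 'I_n -> nat).
Hypothesis num_inj : injective num.

(** Turns arbitrary numbers into values below [n], in reverse order, so that passing to a
    larger-numbered user lowers the value. *)
Definition corank (a : 'I_n) : nat := #|[pred c | (num a < num c)%N]|.

Lemma corank_lt a b : (num a < num b)%N -> (corank b < corank a)%N.
Proof.
move=> ab; apply: proper_card; apply/properP; split.
  by apply/fintype.subsetP => c; rewrite !inE; apply: ltn_trans.
by exists b; rewrite !inE // ltnn.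
Qed.

Lemma corank_inj : injective corank.
Proof.
move=> a b ab; apply: num_inj.
by case: (ltngtP (num a) (num b)) => // /corank_lt; rewrite ab ltnn.
Qed.

Lemma corank_bound a : (corank a < n)%N.
Proof.
rewrite -[X in (_ < X)%N]card_ord; apply: proper_card; apply/properP; split.
  exact/fintype.subsetP.
by exists a; rewrite !inE // ltnn.
Qed.

(** Distinct users have distinct coranks, so the left sum runs over distinct values below
    [corank a]. *)
Lemma sum_corank_le (R : realType) (F : nat -> R) a : (forall m, 0 <= F m) ->
  \sum_(c | (num a < num c)%N) F (corank c) <= \sum_(m < corank a) F m.
Proof.
move=> F0; pose U c := Ordinal (corank_bound c).
have Uinj : injective U by move=> c c' [/corank_inj].
rewrite (big_ord_widen n F (ltnW (corank_bound a))) [X in _ <= X](reindex_inj Uinj) /=.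
rewrite big_mkcond [X in _ <= X]big_mkcond; apply: ler_sum => c _.
by case: ifPn => [/corank_lt ->|_] //; case: ifP.
Qed.

Lemma sum_corank_expr (R : realType) (y : R) a : 1 <= y ->
  (y - 1) * \sum_(c | (num a < num c)%N) y ^+ corank c <= y ^+ corank a.
Proof.
move=> y1; apply: (@le_trans _ _ ((y - 1) * \sum_(m < corank a) y ^+ m)).
  rewrite ler_wpM2l ?subr_ge0 // (@sum_corank_le _ (fun m => y ^+ m)) // => m.
  by rewrite exprn_ge0 // (le_trans ler01).
by rewrite -subrX1 lerBlDr lerDl.
Qed.

End Rank.

(** * Probability that a chain starts at a given edge *)

Section Mass.
Variables (R : realType) (n K : nat) (q : R) (p : 'I_K -> R).
Hypotheses (q0 : 0 <= q) (q1 : q <= 1).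
Hypotheses (p_ge0 : forall k : 'I_K, 0 <= p k) (p_sum1 : \sum_(k < K) p k = 1).

Lemma mass_ge0 (o : outcome n K) : 0 <= mass q p o.
Proof.
apply: mulr_ge0; apply: prodr_ge0 => e _ //.
by case: ifP => // _; rewrite subr_ge0.
Qed.

Lemma sum_mass_supset (S : {set user_pair n}) :
  \sum_(o : outcome n K | S \subset o.1) mass q p o = q ^+ #|S|.
Proof.
pose F (A : {set user_pair n}) : R := \prod_e (if e \in A then q else 1 - q).
pose G (f : {ffun user_pair n -> 'I_K}) : R := \prod_e p (f e).
transitivity (\sum_(A : {set user_pair n} | S \subset A) \sum_f F A * G f).
  by rewrite pair_big; apply: eq_bigl => o; rewrite /= andbT.
have sumG : \sum_f G f = 1.
  by rewrite -(bigA_distr_bigA (fun _ => p)) big1.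
under eq_bigr do rewrite -mulr_sumr sumG mulr1.
have -> : q ^+ #|S| = \prod_(e : user_pair n) (if e \in S then q else 1).
  by rewrite -big_mkcond prodr_const.
(* Each factor is split into presence plus absence, absence being given the value 0 on [S];
   expanding the product then leaves only the sets containing [S]. *)
rewrite (eq_bigr (fun e => q + (if e \in S then 0 else 1 - q))); last first.
  by move=> e _; case: ifP; rewrite ?addr0 // addrC subrK.
rewrite bigA_distr [RHS](bigID (fun A : {set user_pair n} => S \subset A)) /=.
rewrite [X in _ = _ + X]big1 ?addr0; last first.
  move=> A /fintype.subsetPn[e eS eA]; rewrite (bigD1 e) //= (negbTE eA) eS mul0r //.
apply: eq_bigr => A /fintype.subsetP SA; apply: eq_bigr => e _.
by case: ifPn => // eA; case: ifPn => // /SA; rewrite (negbTE eA).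
Qed.

Variable num : 'I_n -> nat.
Hypothesis num_inj : injective num.

Let rk := corank num.

(** Lets corank sums tell edges apart, whatever the order in which [pair_of] stores the ends. *)
Lemma pair_of_rk (a b : 'I_n) e : pair_of a b = Some e ->
  (rk (val e).1 + rk (val e).2)%N = (rk a + rk b)%N.
Proof.
rewrite /pair_of; case: insubP => // e' _ ve [<-]; rewrite ve; case: ifP => _ //=.
by rewrite addnC.
Qed.

(* S is the set of edges already used by the chain: the edge (a, b) cannot be
   in S because its corank sum is smaller than those of S, so each step of
   the induction gains an independent factor q. *)
Lemma chain_mass_le (z : R) s (S : {set user_pair n}) a b : 0 < z ->
  (forall e, e \in S -> (rk a + rk b < rk (val e).1 + rk (val e).2)%N) ->
  \sum_(o : outcome n K | (S \subset o.1) && chain (adj_of o) num s a b) mass q p o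
  <= q ^+ (#|S| + s.+1) * (1 + 2 * z) ^+ (rk a + rk b) / z ^+ s.
Proof.
move=> z0; elim: s S a b => [|s IH] S a b Slt;
  (case ab : (pair_of a b) => [e|]; last first).
- rewrite big_pred0 => [|o]; last by rewrite /= /adj_of ab andbF.
  by rewrite !(divr_ge0, mulr_ge0, exprn_ge0, addr_ge0) // ltW.
- have eS : e \notin S by apply/negP => /Slt; rewrite (pair_of_rk ab) ltnn.
  rewrite (eq_bigl (fun o : outcome n K => (e |: S) \subset o.1)); last first.
    by move=> o; rewrite /= /adj_of ab andbT finset.subUset finset.sub1set andbC.
  rewrite sum_mass_supset cardsU1 eS addnC divr1 ler_peMr ?exprn_ge0 //.
  by rewrite exprn_ege1 // lerDl mulr_ge0 // ltW.
- rewrite big_pred0 => [|o]; last by rewrite /= /adj_of ab andbF.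
  by rewrite !(divr_ge0, mulr_ge0, exprn_ge0, addr_ge0) // ltW.
have eS : e \notin S by apply/negP => /Slt; rewrite (pair_of_rk ab) ltnn.
(* With [y - 1 = 2 * z], the sum over the replacing user costs at most a factor [1 / (2 * z)]; the
   two choices of the replaced end together give one [1 / z]. *)
set y := 1 + 2 * z in IH *.
have y1 : 1 <= y by rewrite lerDl mulr_ge0 // ltW.
have y0 : 0 <= y by apply: le_trans y1.
pose S' := e |: S; pose M := q ^+ (#|S| + s.+2) / z ^+ s.
have M0 : 0 <= M by rewrite divr_ge0 ?exprn_ge0 // ltW.
have IH' x x' : (rk x + rk x' < rk a + rk b)%N ->
  \sum_(o : outcome n K | (S' \subset o.1) && chain (adj_of o) num s x x') mass q p o
  <= M * (y ^+ rk x * y ^+ rk x').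
  move=> lt; apply: le_trans (IH S' x x' _) _.
    move=> f; rewrite !inE => /orP[/eqP ->|/Slt]; first by rewrite (pair_of_rk ab).
    exact: ltn_trans.
  by rewrite cardsU1 eS add1n addSnnS [y ^+ (_ + _)]exprD /M mulrAC.
pose Q1 c (o : outcome n K) := (S' \subset o.1) && chain (adj_of o) num s a c.
pose Q2 c (o : outcome n K) := (S' \subset o.1) && chain (adj_of o) num s c b.
have half : M * (y ^+ rk a * y ^+ rk b) / (2 * z) + M * (y ^+ rk a * y ^+ rk b) / (2 * z)
    = q ^+ (#|S| + s.+2) * y ^+ (rk a + rk b) / z ^+ s.+1.
  rewrite [y ^+ (_ + _)]exprD exprS /M.
  have := lt0r_neq0 z0; have := expf_neq0 s (lt0r_neq0 z0).
  move: (q ^+ _) (z ^+ s) (y ^+ rk a) (y ^+ rk b) => ? ? ? ? ? ?.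
  by field; apply/andP.
rewrite -half; clearbody M.
(* Once [e] is moved into the set of required edges, the event is covered by the two kinds of
   replacement. *)
apply: le_trans (_ : \sum_(o : outcome n K | [exists c, (num b < num c)%N && Q1 c o] ||
   [exists c, (num a < num c)%N && Q2 c o]) mass q p o <= _).
  rewrite [X in X <= _]big_mkcond [X in _ <= X]big_mkcond; apply: ler_sum => o _.
  case: ifPn => [|_]; last by case: ifP; rewrite ?mass_ge0.
  rewrite /= {1}/adj_of ab => /and3P[So eo].
  have S'o : S' \subset o.1 by rewrite finset.subUset finset.sub1set eo.
  rewrite /Q1 /Q2 S'o /= => -> //.
apply: le_trans (sum_or_le _ _ mass_ge0) _.
have geo c : \sum_(c' | (num c < num c')%N) y ^+ rk c' <= y ^+ rk c / (2 * z).
  rewrite ler_pdivlMr ?mulr_gt0 // mulrC.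
  have := sum_corank_expr num_inj c y1.
  by rewrite {1}/y addrAC subrr add0r.
apply: lerD; apply: le_trans (sum_exists_le _ _ mass_ge0) _.
  apply: le_trans (_ : \sum_(c | (num b < num c)%N) M * (y ^+ rk a * y ^+ rk c) <= _).
    by apply: ler_sum => c bc; apply: IH'; rewrite ltn_add2l corank_lt.
  by rewrite -!mulr_sumr -!mulrA ler_wpM2l // ler_wpM2l ?exprn_ge0.
apply: le_trans (_ : \sum_(c | (num a < num c)%N) M * (y ^+ rk b * y ^+ rk c) <= _).
  by apply: ler_sum => c ac; rewrite [y ^+ rk b * _]mulrC; apply: IH'; rewrite ltn_add2r corank_lt.
by rewrite -!mulr_sumr [y ^+ rk a * _]mulrC -!mulrA ler_wpM2l // ler_wpM2l ?exprn_ge0.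
Qed.

End Mass.

(** * The random graph meets the assumptions of the chain argument *)

Lemma pair_ofC n (a b : 'I_n) : pair_of a b = pair_of b a.
Proof. by rewrite /pair_of; case: ltngtP => // /val_inj ->. Qed.

Lemma adj_ofC n K (o : outcome n K) : symmetric (adj_of o).
Proof. by move=> a b; rewrite /adj_of pair_ofC. Qed.

Lemma weight_ofC (R : realType) n K (v : 'I_K -> R) (o : outcome n K) a b :
  weight_of v o a b = weight_of v o b a.
Proof. by rewrite /weight_of pair_ofC. Qed.

Lemma weight_of_val (R : realType) n K (v : 'I_K -> R) (o : outcome n K) a b :
  adj_of o a b -> exists k, weight_of v o a b = v k.
Proof. by rewrite /adj_of /weight_of; case: pair_of => // e _; exists (o.2 e). Qed.

(** * Total mass, and passage to the complement *)

Section Prob.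
Variables (R : realType) (n K : nat) (q : R) (p : 'I_K -> R).
Hypotheses (q0 : 0 <= q) (q1 : q <= 1).
Hypotheses (p_ge0 : forall k : 'I_K, 0 <= p k) (p_sum1 : \sum_(k < K) p k = 1).

Lemma sum_mass : \sum_(o : outcome n K) mass q p o = 1.
Proof.
rewrite -(expr0 q) -(cards0 (user_pair n)) -(sum_mass_supset q p_sum1).
by apply: eq_bigl => o; rewrite finset.sub0set.
Qed.

Lemma prob_le1 (A : set (outcome n K)) : prob q p A <= 1.
Proof.
rewrite -sum_mass [X in _ <= X](bigID (mem A)) /= lerDl.
by apply: sumr_ge0 => o _; apply: mass_ge0.
Qed.

Lemma prob_ge (A : set (outcome n K)) (B : pred (outcome n K)) :
  (forall o, ~~ B o -> A o) -> 1 - \sum_(o | B o) mass q p o <= prob q p A.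
Proof.
move=> BA; rewrite -sum_mass (bigID B) /= addrC addrK /prob.
rewrite [X in X <= _]big_mkcond [X in _ <= X]big_mkcond.
apply: ler_sum => o _; case: ifPn => [/BA Ao|_]; first by rewrite mem_set.
by case: ifP => // _; apply: mass_ge0.
Qed.

End Prob.

(** Union bound over the [n ^ 2] ordered pairs of users, each chain starting with no edge used. *)
Lemma chain_prob_le (R : realType) (n K : nat) (p : 'I_K -> R) (d : R)
    (num : 'I_n -> nat) s :
  (forall k : 'I_K, 0 <= p k) -> \sum_(k < K) p k = 1 -> injective num ->
  0 < d -> d <= n%:R -> ln n%:R <= s%:R :> R ->
  \sum_(o : outcome n K | [exists ab : 'I_n * 'I_n, chain (adj_of o) num s ab.1 ab.2])
    mass (d / n%:R) p o <= d * expR (4 * (d * expR 2)) / n%:R.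
Proof.
move=> p0 p1 num_inj d0 dn ns.
have n0 : 0 < n%:R :> R by apply: lt_le_trans dn.
have q0 : 0 <= d / n%:R by rewrite divr_ge0 ?ltW.
have q1 : d / n%:R <= 1 by rewrite ler_pdivrMr // mul1r.
(* Chosen so that [d / n%:R / z = expR (- 2)]: each replacement then gains a constant factor. *)
pose th := d * expR 2.
have th0 : 0 < th by rewrite mulr_gt0 ?expR_gt0.
pose z := th / n%:R; have z0 : 0 < z by rewrite divr_gt0.
have y1 : 1 <= 1 + 2 * z by rewrite lerDl pmulr_lge0 ?ltW.
have y0 := le_trans ler01 y1.
apply: le_trans (sum_exists_le xpredT
  (fun ab o => chain (adj_of o) num s ab.1 ab.2) (mass_ge0 q0 q1 p0)) _.
apply: le_trans (_ : \sum_(ab : 'I_n * 'I_n) (d / n%:R) * (n%:R ^- 2 * expR (4 * th)) <= _).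
  apply: ler_sum => -[a b] _.
  have := @chain_mass_le R n K _ p q0 q1 p0 p1 num num_inj z s finset.set0 a b z0.
  rewrite cards0 add0n.
  under eq_bigl do rewrite finset.sub0set /=.
  move=> /(_ _)/le_trans; apply; first by move=> e; rewrite inE.
  set q := d / n%:R; rewrite exprS -[q * _ * _]mulrA -[q * _ / _]mulrA ler_wpM2l // mulrAC -expr_div_n /q.
  have -> : d / n%:R / z = expR (- 2).
    rewrite /z /th expRN; field; rewrite !lt0r_neq0 ?expR_gt0 //.
  apply: ler_pM; rewrite ?exprn_ge0 ?expR_ge0 //.
    (* As [s] is at least [ln n], the power [expR (- 2) ^+ s] is at most [n ^- 2], which offsets the
       number of pairs. *)
    rewrite -(lnK n0) -!expRM_natl -expRN ler_expR mulrN lerN2.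
    by rewrite [s%:R * _]mulrC ler_wpM2l.
  (* Both coranks are below [n], and [1 + x <= expR x] at [x = 2 * z] turns the power into
     [expR (4 * th)]. *)
  apply: le_trans (_ : expR (2 * z) ^+ (n + n) <= _).
    apply: le_trans (_ : (1 + 2 * z) ^+ (n + n) <= _).
      rewrite ler_weXn2l //.
      by apply: leq_add; apply/ltnW/corank_bound.
    by rewrite lerXn2r ?nnegrE ?expR_ge0 ?expR_ge1Dx.
  rewrite -expRM_natl ler_expR natrD /z le_eqVlt; apply/orP; left; apply/eqP.
  by field; rewrite lt0r_neq0.
rewrite sumr_const card_prod card_ord -[_ *+ (n * n)]mulr_natl natrM le_eqVlt.
by apply/orP; left; apply/eqP; rewrite -/th; field; rewrite lt0r_neq0.
Qed.

Unset Implicit Arguments.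

Theorem proposition10 (R : realType) (K : nat) (v p : 'I_K -> R) (d : R)
    (num : forall n : nat, 'I_n -> nat)
    (v_ge0 : forall k : 'I_K, 0 <= v k)
    (v_incr : forall k l : 'I_K, (k < l)%N -> v k < v l)
    (p_ge0 : forall k : 'I_K, 0 <= p k)
    (p_sum1 : \sum_(k < K) p k = 1)
    (num_inj : forall n : nat, injective (num n))
    (d_gt0 : 0 < d)
    (d_lt : d < 2 / \big[Num.max/0]_(k < K) p k) :
  exists C : R,
    prob (d / n%:R) p
      [set o : outcome n K |
        greedy_runs_within (adj_of o) (weight_of v o) (num n)
          (C * ln n%:R)] @[n --> \oo] --> (1 : R).
Proof.
(* The run takes at most [s * K] iterations, with [s <= 2 * ln n] below. *)
exists (2 * K%:R); pose D := d * expR (4 * (d * expR 2)).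
have invn : (n%:R^-1 : R) @[n --> \oo] --> (0 : R).
  apply/gtr0_cvgV0; last exact: cvgr_idn.
  by near=> n; rewrite ltr0n; near: n; exact: nbhs_infty_gt.
apply: (@squeeze_cvgr _ _ _ _ (fun n => 1 - D / n%:R) (fun=> 1)); last 2 first.
- rewrite -[X in _ --> X]subr0 -[X in 1 - X](mulr0 D).
  by apply: cvgB; [exact: cvg_cst|apply: cvgM => //; exact: cvg_cst].
- exact: cvg_cst.
near=> n.
have dn : d <= n%:R by near: n; exact: nbhs_infty_ger.
(* Gives [1 <= ln n], which absorbs the successor in the definition of [s]. *)
have en : expR 1 <= n%:R :> R by near: n; exact: nbhs_infty_ger.
have n0 : 0 < n%:R :> R by apply: lt_le_trans dn.
have ln1 : 1 <= ln n%:R :> R by rewrite -ler_expR lnK.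
have q0 : 0 <= d / n%:R by rewrite divr_ge0 ?ltW.
have q1 : d / n%:R <= 1 by rewrite ler_pdivrMr // mul1r.
rewrite prob_le1 // andbT.
pose s := (Num.trunc (ln n%:R : R)).+1.
have sn : ln n%:R <= s%:R :> R by apply/ltW/truncnS_gt.
have sn2 : s%:R <= 2 * ln n%:R :> R.
  by rewrite mulr_natl mulr2n /s -natr1 lerD // truncn_le (le_trans ler01).
apply: le_trans (@prob_ge _ _ _ _ _ q0 q1 p_ge0 p_sum1 _
  (fun o => [exists ab, chain (adj_of o) (@num n) s ab.1 ab.2]) _); last first.
  move=> o nB; exists (s * K)%N; split.
    by rewrite natrM mulrAC ler_wpM2r.
  apply: (no_chain_stopped (adj_ofC o) (weight_ofC v o) (@num_inj n) v_incr
    (@weight_of_val _ _ _ v o)) => a b.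
  by apply: contra nB => c; apply/existsP; exists (a, b); exact: c.
by rewrite lerD2l lerN2; apply: chain_prob_le.
Unshelve. all: by end_near.
Qed.
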